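(* Let $W^1,W^2,W^3,\dots$ be a sequence of (not necessarily identical) independent binary-input discrete memoryless channels $W^i:\{0,1\}\to\mathcal{Y}$. For $N=2^n$ write $$\mathbb{A}[I(W^{1:N})]=\frac1N\sum_{i=1}^N I(W^i),$$ and assume that the limit $\bar I=\lim_{n\to\infty}\mathbb{A}[I(W^{1:2^n})]$ exists. Let $W_N^{(1)},\dots,W_N^{(N)}$ be the channels generated from $W^1,\dots,W^N$ by the non-stationary channel transformation $\mathbf{G}_N$ (defined recursively in the context). Then the generated channels polarize: for every fixed $\delta\in(0,1)$, as $N=2^n\to\infty$, $$\frac1N\,\bigl|\{i\in\{1,\dots,N\}: I(W_N^{(i)})\in(1-\delta,1]\}\bigr|\longrightarrow \bar I,$$ $$\frac1N\,\bigl|\{i\in\{1,\dots,N\}: I(W_N^{(i)})\in[0,\delta)\}\bigr|\longrightarrow 1-\bar I .$$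
   Context: A binary-input discrete memoryless channel (B-DMC) $W:\mathcal{X}\to\mathcal{Y}$ has input alphabet $\mathcal{X}=\{0,1\}$, a finite output alphabet $\mathcal{Y}$, and transition probabilities $W(y|x)$ with $W(y|x)\ge 0$ and $\sum_{y}W(y|x)=1$ for each $x$. Its (symmetric) capacity is $I(W)=I(X;Y)$, the mutual information (logarithms to base 2) between a uniform input $X$ on $\{0,1\}$ and the corresponding output $Y$, i.e. $$I(W)=\sum_{y}\sum_{x\in\{0,1\}}\tfrac12 W(y|x)\log_2\frac{W(y|x)}{\tfrac12W(y|0)+\tfrac12W(y|1)}\in[0,1].$$ Kernel operations. For two B-DMCs $V^1:\{0,1\}\to\mathcal{Y}_1$ and $V^2:\{0,1\}\to\mathcal{Y}_2$ define the B-DMCs $V^1\boxplus V^2$ (output alphabet $\mathcal{Y}_1\times\mathcal{Y}_2$) and $V^1\circledast V^2$ (output alphabet $\mathcal{Y}_1\times\mathcal{Y}_2\times\{0,1\}$) by $$(V^1\boxplus V^2)(y^1,y^2|u^1)=\sum_{u^2\in\{0,1\}}\tfrac12 V^1(y^1|u^1\oplus u^2)V^2(y^2|u^2),$$ $$(V^1\circledast V^2)(y^1,y^2,u^1|u^2)=\tfrac12 V^1(y^1|u^1\oplus u^2)V^2(y^2|u^2),$$ where $\oplus$ is addition modulo 2. (Output symbols may be relabelled by any one-to-one mapping; this does not affect $I$.) Non-stationary channel transformation $\mathbf{G}_N$. Let $N=2^n$. Set $W_1^{(i)}=W^i$ for $1\le i\le N$. For $q=0,1,\dots,n-1$, with $Q=2^q$,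 for every integer $k$ with $0\le k\le \frac{N}{2Q}-1$ and every integer $i$ with $2kQ+1\le i\le 2kQ+Q$, set $$W_{2Q}^{(2i-2kQ-1)}=W_Q^{(i)}\boxplus W_Q^{(i+Q)},\qquad W_{2Q}^{(2i-2kQ)}=W_Q^{(i)}\circledast W_Q^{(i+Q)}.$$ After step $q=n-1$ this yields the generated channels $W_N^{(1)},\dots,W_N^{(N)}$. *)

(* Defs.v *)
From HB Require Import structures.
From mathcomp Require Import all_boot all_order all_algebra.
From mathcomp Require Import zify ring lra.
From mathcomp Require Import reals exp.

Set Implicit Arguments.
Unset Strict Implicit.
Unset Printing Implicit Defensive.

Import Order.TTheory GRing.Theory Num.Theory.
Local Open Scope ring_scope.

(* The input alphabet {0,1} is [bool] (false = 0, true = 1), so that addition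
   modulo 2 is exclusive or, written [(+)].  [W x y] is W(y|x). *)
Record bdmc (R : realType) (Y : finType) := Bdmc {
  trans :> bool -> Y -> R;
  trans_ge0 : forall x y, 0 <= trans x y;
  trans_sum1 : forall x, \sum_y trans x y = 1
}.

Definition log2 (R : realType) (r : R) : R := ln r / ln 2.

(* The convention 0 log 0 = 0 holds because [ln] and division are total: a
   term with W(y|x) = 0 vanishes, and W(y|x) > 0 makes the argument of the
   logarithm positive. *)
Definition capacity (R : realType) (Y : finType) (W : bdmc R Y) : R :=
  \sum_(y : Y) \sum_(x : bool)
    2^-1 * W x y * log2 (W x y / (2^-1 * W false y + 2^-1 * W true y)).

Section Kernels.
Variables (R : realType) (Y1 Y2 : finType) (V1 : bdmc R Y1) (V2 : bdmc R Y2).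

Definition box_trans (u1 : bool) (y : Y1 * Y2) : R :=
  \sum_(u2 : bool) 2^-1 * V1 (u1 (+) u2) y.1 * V2 u2 y.2.

Definition star_trans (u2 : bool) (y : Y1 * Y2 * bool) : R :=
  2^-1 * V1 (y.2 (+) u2) y.1.1 * V2 u2 y.1.2.

Lemma box_trans_ge0 u1 y : 0 <= box_trans u1 y.
Proof.
by apply: sumr_ge0 => u2 _; rewrite !mulr_ge0 ?invr_ge0 ?trans_ge0 ?ler0n.
Qed.

Lemma star_trans_ge0 u2 y : 0 <= star_trans u2 y.
Proof. by rewrite !mulr_ge0 ?invr_ge0 ?trans_ge0 ?ler0n. Qed.

Let sum_prod (a b : bool) :
  \sum_(y : Y1 * Y2) 2^-1 * V1 a y.1 * V2 b y.2 = 2^-1.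
Proof.
rewrite -(pair_bigA _ (fun y1 y2 => 2^-1 * V1 a y1 * V2 b y2)) /=.
under eq_bigr => y1 _ do rewrite -mulr_sumr trans_sum1 mulr1.
by rewrite -mulr_sumr trans_sum1 mulr1.
Qed.

Lemma box_trans_sum1 u1 : \sum_y box_trans u1 y = 1.
Proof. by rewrite exchange_big big_bool /= !sum_prod; lra. Qed.

Lemma star_trans_sum1 u2 : \sum_y star_trans u2 y = 1.
Proof.
rewrite -(pair_bigA _ (fun y b => star_trans u2 (y, b))) exchange_big big_bool.
by rewrite /star_trans /= !sum_prod; lra.
Qed.

Definition box : bdmc R (Y1 * Y2)%type := Bdmc box_trans_ge0 box_trans_sum1.

Definition star : bdmc R (Y1 * Y2 * bool)%type :=
  Bdmc star_trans_ge0 star_trans_sum1.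
End Kernels.

(* A B-DMC bundled with its output alphabet: the alphabets of the channels
   generated at one and the same level differ. *)
Record channel (R : realType) := Channel {
  output : finType;
  chan :> bdmc R output
}.
Arguments Channel {R output} _.

Definition cbox (R : realType) (V1 V2 : channel R) : channel R :=
  Channel (box V1 V2).
Definition cstar (R : realType) (V1 V2 : channel R) : channel R :=
  Channel (star V1 V2).

(* The i for which j = 2i - 2kQ - 1 or j = 2i - 2kQ (indices from 1), where
   k = (j - 1) / 2Q. *)
Definition parent (Q j : nat) : nat :=
  (j.-1 %/ (2 * Q) * (2 * Q) + (j.-1 %% (2 * Q))./2).+1.

(* [generated W q j] is W_{2^q}^{(j)}, for j >= 1; it does not depend on N as
   long as 2^q <= N and j <= N.  The defining recursion is [generated_odd] and
   [generated_even] below. *)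
Fixpoint generated (R : realType) (Y : finType) (W : nat -> bdmc R Y)
    (q j : nat) : channel R :=
  if q is q'.+1 then
    let Q := (2 ^ q')%N in
    let i := parent Q j in
    if odd j then cbox (generated W q' i) (generated W q' (i + Q))
    else cstar (generated W q' i) (generated W q' (i + Q))
  else Channel (W j).

Section Recursion.
Local Open Scope nat_scope.

Let parentE (Q k r b : nat) : r < Q -> b < 2 ->
  parent Q (2 * k * Q + 2 * r + b).+1 = (2 * k * Q + r).+1.
Proof.
move=> rQ b2; rewrite /parent /=.
have -> : 2 * k * Q + 2 * r + b = k * (2 * Q) + (2 * r + b) by lia.
have lt : 2 * r + b < 2 * Q by lia.
rewrite divnMDl ?modnMDl; last by lia.
rewrite (divn_small lt) (modn_small lt); lia.
Qed.

Lemma generated_odd (R : realType) (Y : finType) (W : nat -> bdmc R Y)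
    (q k i : nat) (Q := 2 ^ q) : 2 * k * Q + 1 <= i <= 2 * k * Q + Q ->
  generated W q.+1 (2 * i - 2 * k * Q - 1) =
    cbox (generated W q i) (generated W q (i + Q)).
Proof.
move=> /andP[le1 le2]; pose r := i - (2 * k * Q).+1.
have rQ : r < Q by rewrite /r; lia.
have -> : 2 * i - 2 * k * Q - 1 = (2 * k * Q + 2 * r + 0).+1 by rewrite /r; lia.
have -> : i = (2 * k * Q + r).+1 by rewrite /r; lia.
rewrite [LHS]/= -/Q parentE // ifT //; lia.
Qed.

Lemma generated_even (R : realType) (Y : finType) (W : nat -> bdmc R Y)
    (q k i : nat) (Q := 2 ^ q) : 2 * k * Q + 1 <= i <= 2 * k * Q + Q ->
  generated W q.+1 (2 * i - 2 * k * Q) =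
    cstar (generated W q i) (generated W q (i + Q)).
Proof.
move=> /andP[le1 le2]; pose r := i - (2 * k * Q).+1.
have rQ : r < Q by rewrite /r; lia.
have -> : 2 * i - 2 * k * Q = (2 * k * Q + 2 * r + 1).+1 by rewrite /r; lia.
have -> : i = (2 * k * Q + r).+1 by rewrite /r; lia.
rewrite [LHS]/= -/Q parentE // ifF //; lia.
Qed.
End Recursion.

Definition avg_capacity (R : realType) (Y : finType) (W : nat -> bdmc R Y)
    (n : nat) : R :=
  (2 ^ n)%:R^-1 * \sum_(1 <= i < (2 ^ n).+1) capacity (W i).

(* An element [i] of ['I_(2 ^ n)] stands for the index i + 1 of {1,...,2^n}. *)
Definition capacity_fraction (R : realType) (Y : finType)
    (W : nat -> bdmc R Y) (n : nat) (J : interval R) : R :=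
  (2 ^ n)%:R^-1 *
  #|[set i : 'I_(2 ^ n) | capacity (generated W n i.+1) \in J]|%:R.

(* Main.v *)
(** In nats, the capacity is the sum over output symbols of [jsd (W(y|0)) (W(y|1))],
    which is homogeneous and decreases when the same mass is added to both
    arguments.  For box and star channels with capacities I- and I+ made of
    channels of capacities x and y, this gives the chain rule I- + I+ = x + y,
    the bounds I- <= x A and I- <= y B, where A (resp. B) is the total variation
    distance between the two output laws of the channel of capacity y (resp. x);
    since (1 - y)^2 <= 8 (1 - A) and (1 - x)^2 <= 8 (1 - B), it follows that
    (x (1 - x))^2 + (y (1 - y))^2 <= 20 (I+ - I-).

    Fix n and view the channels of level q as 2^(n-q) blocks of length 2^q.  The
    average over the blocks of the capacity at position r is a martingale along
    the binary expansion of r, with values in [0,1], so its squared increments,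
    averaged over r, add up to at most 1 over the n levels: at some level the
    average of I+ - I-, and therefore that of I (1 - I), is small.  As I- and I+
    are more spread out than x and y, the average of I (1 - I) does not increase
    with the level, so it is small at level n too, which is polarization.
    Averaging over the blocks takes care of mediocre channels paired with extreme
    ones, for which x (1 - x) + y (1 - y) need not decrease. *)

Require Import Defs.
From mathcomp Require Import all_boot all_order all_algebra.
From mathcomp Require Import zify ring lra.
From mathcomp Require Import boolp classical_sets reals exp topology normedtype.
Set Implicit Arguments.
Unset Strict Implicit.
Unset Printing Implicit Defensive.

Import Order.TTheory GRing.Theory Num.Theory.
Import numFieldNormedType.Exports.
Local Open Scope classical_set_scope.
Local Open Scope ring_scope.

(** * Divergence of two masses at one output symbol *)

Section Divergence.
Variable R : realType.
Implicit Types a b c d p s t x z : R.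

Lemma ln_le_sub1 x : 0 < x -> ln x <= x - 1.
Proof.
by move=> x0; rewrite -{1}(subrK 1 x) addrC le_ln1Dx // ltrBrDl subrr.
Qed.

Lemma ln2_gt0 : 0 < ln 2 :> R.
Proof. by rewrite ln_gt0 // ltr1n. Qed.

Lemma ln2_ge_half : 2^-1 <= ln 2 :> R.
Proof.
have : ln (2^-1) <= 2^-1 - 1 :> R by apply: ln_le_sub1; lra.
rewrite lnV ?posrE //; lra.
Qed.

(** The tangent bound [ln u <= u - 1] at [u = z * p / x]. The free [z] is a guess for [x / p], at
    which equality holds. *)
Lemma gibbs x p z : 0 <= x -> 0 <= z -> 0 <= p ->
  (p = 0 -> x = 0) -> (z = 0 -> x = 0) ->
  x * ln z + x - p * z <= x * ln (x / p).
Proof.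
move=> x0 z0 p0 px zx.
have [->|xn0] := eqVneq x 0; first by rewrite !mul0r !add0r oppr_le0 mulr_ge0.
have {}x0 : 0 < x by rewrite lt_neqAle eq_sym xn0.
have {}z0 : 0 < z.
  by rewrite lt_neqAle eq_sym z0 andbT (contra_neq zx).
have {}p0 : 0 < p.
  by rewrite lt_neqAle eq_sym p0 andbT (contra_neq px).
have : ln (z * p / x) <= z * p / x - 1.
  by rewrite ln_le_sub1 // divr_gt0 // mulr_gt0.
have -> : ln (z * p / x) = ln z - ln (x / p).
  by rewrite -mulrA -ln_div ?posrE ?divr_gt0 // invf_div.
move=> /(ler_wpM2l (ltW x0)).
have -> : x * (z * p / x - 1) = p * z - x by field; rewrite gt_eqF.
rewrite mulrBr; lra.
Qed.

(** [gibbs] on both terms with the common guess [z], the ratio of the sums. *)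
Lemma log_sum x1 x2 p1 p2 : 0 <= x1 -> 0 <= x2 -> 0 <= p1 -> 0 <= p2 ->
  (p1 = 0 -> x1 = 0) -> (p2 = 0 -> x2 = 0) ->
  (x1 + x2) * ln ((x1 + x2) / (p1 + p2)) <=
    x1 * ln (x1 / p1) + x2 * ln (x2 / p2).
Proof.
move=> x10 x20 p10 p20 px1 px2; set z := (x1 + x2) / (p1 + p2).
have z0 : 0 <= z by rewrite divr_ge0 ?addr_ge0.
have p0 : p1 + p2 = 0 -> x1 + x2 = 0.
  by move=> p0; rewrite px1 ?px2 ?addr0; lra.
have zx : z = 0 -> x1 + x2 = 0.
  by move/eqP; rewrite mulf_eq0 invr_eq0 => /orP[] /eqP.
have pz : (p1 + p2) * z = x1 + x2.
  have [e|n] := eqVneq (p1 + p2) 0; first by rewrite e mul0r p0.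
  by rewrite mulrC divfK.
have := @gibbs x1 p1 z x10 z0 p10 px1 (fun e => ltac:(have := zx e; lra)).
have := @gibbs x2 p2 z x20 z0 p20 px2 (fun e => ltac:(have := zx e; lra)).
rewrite mulrDl; rewrite mulrDl in pz; lra.
Qed.

Definition jsd a b : R :=
  2^-1 * (a * ln (a / ((a + b) / 2)) + b * ln (b / ((a + b) / 2))).

Lemma jsdC a b : jsd a b = jsd b a.
Proof. by rewrite /jsd [a + b]addrC [X in 2^-1 * X]addrC. Qed.

Lemma mul_ln_div_self s : s * ln (s / s) = 0.
Proof.
have [->|s0] := eqVneq s 0; first by rewrite mul0r.
by rewrite divff // ln1 mulr0.
Qed.

Lemma jsdxx s : jsd s s = 0.
Proof.
rewrite /jsd; have -> : (s + s) / 2 = s by field.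
by rewrite mul_ln_div_self addr0 mulr0.
Qed.

Lemma jsdZ t a b : 0 <= t -> jsd (t * a) (t * b) = t * jsd a b.
Proof.
rewrite le_eqVlt => /predU1P[<-|t0]; first by rewrite !mul0r jsdxx.
rewrite /jsd -mulrDr -[t * (a + b) / 2]mulrA.
by rewrite -!(mulf_div t t) divff ?mul1r ?gt_eqF //; ring.
Qed.

(** [log_sum] splits off the common mass [s], whose own term vanishes. *)
Lemma jsd_addl s a b : 0 <= s -> 0 <= a -> 0 <= b ->
  jsd (s + a) (s + b) <= jsd a b.
Proof.
move=> s0 a0 b0; rewrite /jsd.
have -> : (s + a + (s + b)) / 2 = s + (a + b) / 2 by field.
have p0 : 0 <= (a + b) / 2 by lra.
rewrite ler_pM2l; last by lra.
have := @log_sum s a s ((a + b) / 2) s0 a0 s0 p0 id ltac:(lra).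
have := @log_sum s b s ((a + b) / 2) s0 b0 s0 p0 id ltac:(lra).
rewrite mul_ln_div_self; lra.
Qed.

Lemma jsd_ge0 a b : 0 <= a -> 0 <= b -> 0 <= jsd a b.
Proof.
move=> a0 b0; have p0 : 0 <= (a + b) / 2 by lra.
have z : (1 : R) = 0 -> forall x, x = 0 by move/eqP; rewrite oner_eq0.
have := @gibbs a ((a + b) / 2) 1 a0 ler01 p0 ltac:(lra) (z^~ _).
have := @gibbs b ((a + b) / 2) 1 b0 ler01 p0 ltac:(lra) (z^~ _).
rewrite /jsd ln1; lra.
Qed.

Lemma jsd0r a : 0 <= a -> jsd a 0 = a / 2 * ln 2.
Proof.
rewrite /jsd le_eqVlt addr0 mul0r addr0 => /predU1P[<-|a0].
  by rewrite !mul0r mulr0.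
have -> : a / (a / 2) = 2 by field; rewrite gt_eqF.
by ring.
Qed.

(** For [b <= a], dropping the common mass [b] leaves [jsd (a - b) 0], which is explicit. *)
Lemma jsd_le_dist a b : 0 <= a -> 0 <= b -> jsd a b <= `|a - b| / 2 * ln 2.
Proof.
wlog ab : a b / b <= a => [hw a0 b0|a0 b0].
  case: (leP b a) => [/hw|/ltW/hw]; first exact.
  by rewrite jsdC distrC; apply.
have d0 : 0 <= a - b by lra.
rewrite (ger0_norm d0) -jsd0r //.
by have := jsd_addl b0 d0 (lexx 0); rewrite addrC subrK addr0.
Qed.

(* The defect of [jsd] from its maximal value, to be summed over the output
   alphabet with a common [t], which replaces the Cauchy-Schwarz inequality. *)
Lemma jsd_defect a b t : 0 <= a -> 0 <= b -> 0 < t ->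
  2 * ((a + b) / 2 * ln 2 - jsd a b) <=
    t * (a + b) + ((a + b) / 2 - `|a - b| / 2) / t.
Proof.
wlog ab : a b / a <= b => [hw a0 b0 t0|a0 b0 t0].
  case: (leP a b) => [/hw|/ltW/hw]; first exact.
  by rewrite jsdC distrC [a + b]addrC; apply.
have -> : (a + b) / 2 - `|a - b| / 2 = a.
  by rewrite distrC ger0_norm; lra.
have p0 : 0 <= (a + b) / 2 by lra.
have t20 : 0 <= 2 * t by lra.
(* Guesses for a nearly noiseless symbol: the smaller [a] is about [2 * t] times the mean, [b] about
   twice the mean. *)
have := @gibbs a ((a + b) / 2) (2 * t) a0 t20 p0 ltac:(lra) ltac:(lra).
have := @gibbs b ((a + b) / 2) 2 b0 ltac:(lra) p0 ltac:(lra) ltac:(lra).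
rewrite (@lnM _ 2 t) ?posrE // /jsd.
have : a * - ln t <= a / t - a.
  rewrite -lnV ?posrE // -[X in _ - X]mulr1 -mulrBr ler_wpM2l //.
  by rewrite ln_le_sub1 ?invr_gt0.
lra.
Qed.

(** For [d <= c] both arguments contain the mass [d * (a + b)]; dropping it leaves [c - d] times the
    pair [a], [b]. *)
Lemma jsd_mix a b c d : 0 <= a -> 0 <= b -> 0 <= c -> 0 <= d ->
  jsd (a * c + b * d) (b * c + a * d) <= `|c - d| * jsd a b.
Proof.
move=> a0 b0; wlog cd : c d / d <= c => [hw c0 d0|c0 d0].
  case: (leP d c) => [/hw|/ltW/hw]; first exact.
  by rewrite distrC jsdC [b * c + _]addrC [a * c + _]addrC; apply.
have e0 : 0 <= c - d by lra.
rewrite (ger0_norm e0) -(jsdZ _ _ e0).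
have -> : a * c + b * d = d * (a + b) + (c - d) * a by ring.
have -> : b * c + a * d = d * (a + b) + (c - d) * b by ring.
by rewrite jsd_addl ?mulr_ge0 // addr_ge0.
Qed.

(** The convex function whose Jensen gap is [jsd]. Its product rule, valid also at 0, turns the
    chain rule into a field identity. *)
Definition xlnx x : R := x * ln x.

Lemma xlnxM x z : 0 <= x -> 0 <= z -> xlnx (x * z) = x * xlnx z + z * xlnx x.
Proof.
rewrite /xlnx le_eqVlt => /predU1P[<-|x0]; first by rewrite !(mul0r, mulr0, addr0).
rewrite le_eqVlt => /predU1P[<-|z0]; first by rewrite !(mul0r, mulr0, addr0).
by rewrite lnM ?posrE //; ring.
Qed.

Lemma jsdE a b : 0 <= a -> 0 <= b ->
  jsd a b = 2^-1 * (xlnx a + xlnx b) - xlnx ((a + b) / 2).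
Proof.
move=> a0 b0; have p0 : 0 <= (a + b) / 2 by lra.
have h x : 0 <= x -> ((a + b) / 2 = 0 -> x = 0) ->
    x * ln (x / ((a + b) / 2)) = xlnx x - x * ln ((a + b) / 2).
  move=> x0 px; rewrite /xlnx.
  have [->|xn0] := eqVneq x 0; first by rewrite !mul0r subrr.
  rewrite ln_div ?mulrBr // posrE lt_neqAle eq_sym; first by rewrite xn0.
  by rewrite p0 (contra_neq px).
by rewrite /jsd !h //; try lra; rewrite [xlnx (_ / 2)]/xlnx; field.
Qed.

(* Chain rule for mutual information, one pair of output symbols at a time. *)
Lemma jsd_chain a b c d : 0 <= a -> 0 <= b -> 0 <= c -> 0 <= d ->
  jsd ((a * c + b * d) / 2) ((b * c + a * d) / 2) +
    (jsd (a * c / 2) (b * d / 2) + jsd (b * c / 2) (a * d / 2)) =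
  (c + d) / 2 * jsd a b + (a + b) / 2 * jsd c d.
Proof.
move=> a0 b0 c0 d0.
have h0 : 0 <= 2^-1 :> R by lra.
rewrite !jsdE ?divr_ge0 ?mulr_ge0 ?addr_ge0 ?mulr_ge0 //.
(* The box mean factors into the two input means; each star mean is half a box argument, so these
   terms cancel. *)
have -> : ((a * c + b * d) / 2 + (b * c + a * d) / 2) / 2 =
    (a + b) / 2 * ((c + d) / 2).
  by field.
have -> : (a * c / 2 + b * d / 2) / 2 = ((a * c + b * d) / 2) / 2 by field.
have -> : (b * c / 2 + a * d / 2) / 2 = ((b * c + a * d) / 2) / 2 by field.
have s0 : 0 <= (a * c + b * d) / 2 by rewrite divr_ge0 ?addr_ge0 ?mulr_ge0.
have s'0 : 0 <= (b * c + a * d) / 2 by rewrite divr_ge0 ?addr_ge0 ?mulr_ge0.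
rewrite (xlnxM s0 h0) (xlnxM s'0 h0).
rewrite (@xlnxM ((a + b) / 2)) ?divr_ge0 ?addr_ge0 //.
rewrite !(@xlnxM (_ * _) 2^-1) ?mulr_ge0 ?addr_ge0 //.
rewrite !(@xlnxM _ c) // !(@xlnxM _ d) //.
by field.
Qed.

End Divergence.

(** * Energy of block averages and decay of the spread *)

Section Averages.
Variable R : realType.

Lemma pow4 n : 4 ^+ n = (2 ^+ n) ^+ 2 :> R.
Proof. by rewrite -exprM mulnC exprM; congr (_ ^+ _); ring. Qed.

Lemma sum_nat_double (h : nat -> R) n :
  \sum_(0 <= k < 2 * n) h k = \sum_(0 <= k < n) (h (2 * k)%N + h (2 * k).+1).
Proof.
elim: n => [|n IH]; first by rewrite muln0 !big_geq.
by rewrite mulnS !addSn add0n !big_nat_recr //= IH addrA.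
Qed.

(** Cauchy-Schwarz against the constant 1; the induction step expands the sum of
    [(h k - h n) ^+ 2]. *)
Lemma sqr_sum_le (h : nat -> R) n :
  (\sum_(0 <= k < n) h k) ^+ 2 <= n%:R * \sum_(0 <= k < n) h k ^+ 2.
Proof.
elim: n => [|n IH]; first by rewrite !big_geq // expr0n mul0r.
rewrite !big_nat_recr //=; set s := \sum_(0 <= k < n) h k in IH *.
set u := \sum_(0 <= k < n) h k ^+ 2 in IH *.
have : 0 <= \sum_(0 <= k < n) (h k - h n) ^+ 2.
  by apply: sumr_ge0 => k _; exact: sqr_ge0.
have -> : \sum_(0 <= k < n) (h k - h n) ^+ 2 = u - 2 * h n * s + n%:R * h n ^+ 2.
  have -> : n%:R * h n ^+ 2 = \sum_(0 <= k < n) h n ^+ 2.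
    by rewrite sumr_const_nat subn0 mulr_natl.
  by rewrite /u /s mulr_sumr -sumrB -big_split; apply: eq_bigr => k _ /=; ring.
rewrite -natr1; nra.
Qed.

(** [F q k r] models the capacity at position [r] of block [k] on level [q]. Blocks [2 * k] and
    [(2 * k).+1] merge into block [k], with the box child at [2 * r] and the star child at
    [(2 * r).+1]. *)
Variable F : nat -> nat -> nat -> R.
Hypothesis F01 : forall q k r, 0 <= F q k r <= 1.
Hypothesis F_sum : forall q k r, (r < 2 ^ q)%N ->
  F q.+1 k (2 * r) + F q.+1 k (2 * r).+1 = F q (2 * k) r + F q (2 * k).+1 r.
Hypothesis F_lel : forall q k r, (r < 2 ^ q)%N ->
  F q.+1 k (2 * r) <= F q (2 * k) r.
Hypothesis F_ler : forall q k r, (r < 2 ^ q)%N ->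
  F q.+1 k (2 * r) <= F q (2 * k).+1 r.

Let T (x : R) := x * (1 - x).
Variable C : R.
Hypothesis F_gap : forall q k r, (r < 2 ^ q)%N ->
  T (F q (2 * k) r) ^+ 2 + T (F q (2 * k).+1 r) ^+ 2 <=
  C * (F q.+1 k (2 * r).+1 - F q.+1 k (2 * r)).

(** [p] counts the levels still to come: [2 ^ p] blocks of length [2 ^ q] with [q + p = n]. *)
Definition level_sum (g : R -> R) (q p : nat) : R :=
  \sum_(0 <= r < 2 ^ q) \sum_(0 <= k < 2 ^ p) g (F q k r).

Lemma level_sum_parents g q p : level_sum g q p.+1 =
  \sum_(0 <= r < 2 ^ q) \sum_(0 <= k < 2 ^ p)
    (g (F q (2 * k) r) + g (F q (2 * k).+1 r)).
Proof. by apply: eq_bigr => r _; rewrite expnS sum_nat_double. Qed.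

Lemma level_sum_children g q p : level_sum g q.+1 p =
  \sum_(0 <= r < 2 ^ q) \sum_(0 <= k < 2 ^ p)
    (g (F q.+1 k (2 * r)) + g (F q.+1 k (2 * r).+1)).
Proof.
rewrite /level_sum expnS sum_nat_double.
by apply: eq_bigr => r _; rewrite -big_split.
Qed.

Lemma level_sum_id q p : level_sum id q.+1 p = level_sum id q p.+1.
Proof.
rewrite level_sum_parents level_sum_children.
by apply: eq_big_nat => r rq; apply: eq_bigr => k _; exact: F_sum.
Qed.

(** For parents [x], [y] and children [u], [v] of equal sum, the spread drops by [2 * (x * y - u *
    v) = 2 * (x - u) * (y - u)], which is nonnegative as the box child [u] is below both parents. *)
Lemma level_sum_spread_le q p : level_sum T q.+1 p <= level_sum T q p.+1.
Proof.
rewrite level_sum_parents level_sum_children.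
apply: ler_sum_nat => r rq; apply: ler_sum => k _; rewrite /T.
have rq' : (r < 2 ^ q)%N by lia.
have := F_sum k rq'; have := F_lel k rq'; have := F_ler k rq'.
nra.
Qed.

(** The martingale before division by [2 ^ p]; [energy] is its second moment before division by
    [2 ^ q * 4 ^ p]. *)
Definition mean_sum (q p r : nat) : R := \sum_(0 <= k < 2 ^ p) F q k r.
Definition energy (q p : nat) : R := \sum_(0 <= r < 2 ^ q) mean_sum q p r ^+ 2.

Definition gap (q p r : nat) := mean_sum q.+1 p (2 * r).+1 - mean_sum q.+1 p (2 * r).

(** The identity [2 * (u ^+ 2 + v ^+ 2) - (u + v) ^+ 2 = (v - u) ^+ 2], as the parents' sum equals
    that of the children [u], [v]. *)
Lemma energy_step q p :
  2 * energy q.+1 p - energy q p.+1 = \sum_(0 <= r < 2 ^ q) gap q p r ^+ 2.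
Proof.
rewrite /energy expnS sum_nat_double mulr_sumr -sumrB.
apply: eq_big_nat => r rq.
have -> : mean_sum q p.+1 r = mean_sum q.+1 p (2 * r) + mean_sum q.+1 p (2 * r).+1.
  rewrite /mean_sum expnS sum_nat_double -big_split /=.
  by apply: eq_bigr => k _; rewrite F_sum //; lia.
rewrite /gap; ring.
Qed.

Lemma energy_ge0 q p : 0 <= energy q p.
Proof. by apply: sumr_ge0 => r _; exact: sqr_ge0. Qed.

Lemma energy_le q p : energy q p <= 2 ^+ q * 4 ^+ p.
Proof.
have -> : 2 ^+ q * 4 ^+ p = \sum_(0 <= r < 2 ^ q) 4 ^+ p :> R.
  by rewrite sumr_const_nat subn0 -natrX mulr_natl.
apply: ler_sum => r _.
have h0 : 0 <= mean_sum q p r by apply: sumr_ge0 => k _; case/andP: (F01 q k r).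
have h1 : mean_sum q p r <= 2 ^+ p.
  rewrite -natrX -[X in X%:R]subn0 -[X in _ <= X]mulr1 mulr_natl -sumr_const_nat.
  by apply: ler_sum => k _; case/andP: (F01 q k r).
rewrite pow4.
by rewrite ler_pXn2r ?nnegrE ?exprn_ge0.
Qed.

(** Cauchy-Schwarz twice: over all [2 ^ n] channels, where [F_gap] bounds the squares by the total
    gap, then over the [2 ^ q] positions, to reach the squared gaps of [energy_step]. *)
Lemma level_sum_spread4 q p n : (p + q).+1 = n ->
  level_sum T q p.+1 ^+ 4 <=
    C ^+ 2 * 4 ^+ n * 2 ^+ q * (2 * energy q.+1 p - energy q p.+1).
Proof.
move=> pqn; set G := \sum_(0 <= r < 2 ^ q) gap q p r.
have S2 : level_sum T q p.+1 ^+ 2 <= 2 ^+ n * (C * G).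
  apply: (@le_trans _ _ (2 ^+ n * level_sum (fun x => T x ^+ 2) q p.+1)).
    rewrite -pqn -addSn addnC exprD -mulrA.
    apply: le_trans (sqr_sum_le _ _) _.
    rewrite natrX ler_wpM2l ?exprn_ge0 // mulr_sumr.
    by apply: ler_sum => r _; rewrite -natrX sqr_sum_le.
  rewrite ler_wpM2l ?exprn_ge0 // level_sum_parents /G mulr_sumr.
  apply: ler_sum_nat => r rq.
  rewrite /gap /mean_sum -sumrB mulr_sumr; apply: ler_sum => k _; apply: F_gap; lia.
rewrite energy_step -[4%N]/(2 * 2)%N exprM.
apply: (@le_trans _ _ ((2 ^+ n * (C * G)) ^+ 2)).
  by rewrite ler_pXn2r // nnegrE ?sqr_ge0 // (le_trans (sqr_ge0 _) S2).
have -> : (2 ^+ n * (C * G)) ^+ 2 = C ^+ 2 * 4 ^+ n * G ^+ 2.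
  rewrite pow4.
  by ring.
rewrite -[X in _ <= X]mulrA ler_wpM2l ?(mulr_ge0 (sqr_ge0 _)) ?exprn_ge0 //.
by rewrite -natrX sqr_sum_le.
Qed.

Lemma level_sum_spread_mono n q p : (q + p)%N = n ->
  level_sum T n 0 <= level_sum T q p.
Proof.
elim: p q => [|p IH] q; first by rewrite addn0 => ->.
rewrite addnS -addSn => /IH h; exact: le_trans h (level_sum_spread_le q p).
Qed.

Lemma level_sum_spread_ge0 q p : 0 <= level_sum T q p.
Proof.
apply: sumr_ge0 => r _; apply: sumr_ge0 => k _; rewrite /T.
by have /andP[h0 h1] := F01 q k r; rewrite mulr_ge0 ?subr_ge0.
Qed.

(** The final spread is at most that of every earlier level, so each of the [n] energy increments
    dominates the same [s ^+ 4]; they telescope to at most 1. *)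
Lemma spread_decay n :
  n%:R * ((2 ^+ n)^-1 * level_sum T n 0) ^+ 4 <= C ^+ 2.
Proof.
set s := (2 ^+ n)^-1 * level_sum T n 0.
(* The denominator equals [2 ^ q * 4 ^ (n - q)], the bound of [energy_le], so [e] has values in
   [0,1]. *)
pose e q := energy q (n - q) / (2 ^+ n * 2 ^+ (n - q)).
have step q : (q < n)%N -> s ^+ 4 <= C ^+ 2 * (e q.+1 - e q).
  move=> qn; set p := (n - q.+1)%N.
  have np : (n - q = p.+1)%N by rewrite /p; lia.
  have pqn : (p + q).+1 = n by rewrite /p; lia.
  rewrite /s exprMn /e np -/p.
  have h : level_sum T n 0 ^+ 4 <= level_sum T q p.+1 ^+ 4.
    rewrite ler_pXn2r ?nnegrE ?level_sum_spread_ge0 //.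
    by apply: level_sum_spread_mono; rewrite -pqn; lia.
  have n0 : 0 < 2 ^+ n :> R by rewrite exprn_gt0.
  have p0 : 0 < 2 ^+ p :> R by rewrite exprn_gt0.
  have q0 : 0 < 2 ^+ q :> R by rewrite exprn_gt0.
  have := le_trans h (level_sum_spread4 pqn).
  rewrite -(ler_pM2l (_ : 0 < ((2 ^+ n)^-1) ^+ 4)) ?exprn_gt0 ?invr_gt0 //.
  move=> /le_trans; apply.
  rewrite pow4.
  have -> : 2 ^+ n = 2 * (2 ^+ p * 2 ^+ q) :> R by rewrite -pqn exprS exprD.
  rewrite [2 ^+ p.+1]exprS le_eqVlt; apply/orP; left; apply/eqP.
  by field; rewrite !gt_eqF.
have -> : n%:R * s ^+ 4 = \sum_(0 <= q < n) s ^+ 4.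
  by rewrite sumr_const_nat subn0 mulr_natl.
apply: (@le_trans _ _ (\sum_(0 <= q < n) C ^+ 2 * (e q.+1 - e q))).
  by apply: ler_sum_nat => q /andP[_ qn]; exact: step.
rewrite -mulr_sumr telescope_sumr // -[X in _ <= X]mulr1.
rewrite ler_wpM2l ?sqr_ge0 // /e subnn subn0.
have h0 : 0 <= energy 0 n / (2 ^+ n * 2 ^+ n).
  by rewrite divr_ge0 ?energy_ge0 ?mulr_ge0 ?exprn_ge0.
have h1 : energy n 0 / (2 ^+ n * 2 ^+ 0) <= 1.
  rewrite ler_pdivrMr ?mulr_gt0 ?exprn_gt0 // mul1r.
  by have := energy_le n 0; rewrite !expr0.
lra.
Qed.

End Averages.

(** * Capacity and total variation under the kernel operations *)

Section Capacity.
Variable R : realType.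

Lemma capacityE (Y : finType) (V : bdmc R Y) :
  capacity V = (\sum_y jsd (V false y) (V true y)) / ln 2.
Proof.
rewrite /capacity mulr_suml; apply: eq_bigr => y _.
rewrite big_bool /= /log2 /jsd.
have -> : 2^-1 * V false y + 2^-1 * V true y = (V false y + V true y) / 2.
  by field.
ring.
Qed.

Definition total_variation (Y : finType) (V : bdmc R Y) : R :=
  \sum_y `|V false y - V true y| / 2.

Lemma sum_half_trans (Y : finType) (V : bdmc R Y) :
  \sum_y (V false y + V true y) / 2 = 1.
Proof. by rewrite -mulr_suml big_split !trans_sum1 /=; field. Qed.

Lemma total_variation_le1 (Y : finType) (V : bdmc R Y) :
  total_variation V <= 1.
Proof.
rewrite -(sum_half_trans V); apply: ler_sum => y _.
rewrite ler_pM2r ?invr_gt0 //.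
by rewrite (le_trans (ler_normB _ _)) // !ger0_norm ?trans_ge0.
Qed.

Lemma capacity_ge0 (Y : finType) (V : bdmc R Y) : 0 <= capacity V.
Proof.
rewrite capacityE divr_ge0 ?(ltW (ln2_gt0 R)) //.
by apply: sumr_ge0 => y _; rewrite jsd_ge0 ?trans_ge0.
Qed.

Lemma capacity_le_total_variation (Y : finType) (V : bdmc R Y) :
  capacity V <= total_variation V.
Proof.
rewrite capacityE ler_pdivrMr ?ln2_gt0 // mulr_suml.
by apply: ler_sum => y _; rewrite jsd_le_dist ?trans_ge0.
Qed.

Lemma capacity_le1 (Y : finType) (V : bdmc R Y) : capacity V <= 1.
Proof.
exact: le_trans (capacity_le_total_variation V) (total_variation_le1 V).
Qed.

Lemma sqr_capacity_defect (Y : finType) (V : bdmc R Y) :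
  (1 - capacity V) ^+ 2 <= 8 * (1 - total_variation V).
Proof.
set I := capacity V; set A := total_variation V.
have I1 : I <= 1 := capacity_le1 V.
have A1 : A <= 1 := total_variation_le1 V.
have [e|In1] := eqVneq I 1; first by rewrite e subrr expr0n mulr_ge0 // subr_ge0.
have {}I1 : 0 < 1 - I by rewrite subr_gt0 lt_neqAle In1.
have key t : 0 < t -> 1 - I <= 2 * t + (1 - A) / t.
  move=> t0.
  have : 2 * ln 2 * (1 - I) <= 2 * t + (1 - A) / t.
    have -> : 2 * t + (1 - A) / t =
        \sum_y (t * (V false y + V true y) +
          ((V false y + V true y) / 2 - `|V false y - V true y| / 2) / t).
      rewrite big_split -mulr_sumr -mulr_suml sumrB sum_half_trans big_split /=.
      by rewrite !trans_sum1 mulrC.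
    have -> : 2 * ln 2 * (1 - I) =
        \sum_y 2 * ((V false y + V true y) / 2 * ln 2 -
                    jsd (V false y) (V true y)).
      rewrite -mulr_sumr sumrB -mulr_suml sum_half_trans /I capacityE.
      by field; rewrite gt_eqF ?ln2_gt0.
    by apply: ler_sum => y _; rewrite jsd_defect ?trans_ge0.
  by have := ln2_ge_half R; nra.
(* With this [t], the term [2 * t] absorbs half of [1 - I], which yields the constant 8. *)
have t0 : 0 < (1 - I) / 4 by lra.
have := key _ t0.
have -> : (1 - A) / ((1 - I) / 4) = 4 * ((1 - A) / (1 - I)) by field; rewrite gt_eqF.
have : (1 - A) / (1 - I) * (1 - I) = 1 - A by rewrite divfK ?gt_eqF.
nra.
Qed.

Variables (Y1 Y2 : finType) (V1 : bdmc R Y1) (V2 : bdmc R Y2).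

Let box_jsd (y : Y1 * Y2) :
  jsd (box V1 V2 false y) (box V1 V2 true y) =
  jsd ((V1 false y.1 * V2 false y.2 + V1 true y.1 * V2 true y.2) / 2)
        ((V1 true y.1 * V2 false y.2 + V1 false y.1 * V2 true y.2) / 2).
Proof. by rewrite /= /box_trans !big_bool /=; congr jsd; ring. Qed.

(** [jsd_chain] summed over output pairs; the weight of each divergence is the mean output law of
    the other channel and sums to 1. *)
Lemma capacity_box_star :
  capacity (box V1 V2) + capacity (star V1 V2) = capacity V1 + capacity V2.
Proof.
rewrite !capacityE -!mulrDl; congr (_ / _).
rewrite -(pair_bigA _ (fun y b =>
  jsd (star V1 V2 false (y, b)) (star V1 V2 true (y, b)))) /=.
rewrite -big_split /=.
transitivity (\sum_(y : Y1 * Y2)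
    ((V2 false y.2 + V2 true y.2) / 2 * jsd (V1 false y.1) (V1 true y.1) +
     (V1 false y.1 + V1 true y.1) / 2 * jsd (V2 false y.2) (V2 true y.2))).
  apply: eq_bigr => y _; rewrite -jsd_chain ?trans_ge0 // -box_jsd; congr (_ + _).
  by rewrite big_bool addrC /star_trans /=; congr (jsd _ _ + jsd _ _); ring.
rewrite big_split /=; congr (_ + _).
  rewrite -(pair_bigA _ (fun y1 y2 => (V2 false y2 + V2 true y2) / 2 *
    jsd (V1 false y1) (V1 true y1))) /=.
  by apply: eq_bigr => y1 _; rewrite -mulr_suml sum_half_trans mul1r.
rewrite -(pair_bigA _ (fun y1 y2 => (V1 false y1 + V1 true y1) / 2 *
    jsd (V2 false y2) (V2 true y2))) exchange_big /=.
by apply: eq_bigr => y2 _; rewrite -mulr_suml sum_half_trans mul1r.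
Qed.

(** [jsd_mix] at each output pair, with [V2] supplying the mixing weights [c], [d]. *)
Lemma capacity_box_lel : capacity (box V1 V2) <= capacity V1 * total_variation V2.
Proof.
rewrite !capacityE -mulrAC ler_pM2r ?invr_gt0 ?ln2_gt0 // mulr_suml.
under [X in _ <= X]eq_bigr => y1 _ do rewrite mulr_sumr.
rewrite (pair_bigA _ (fun y1 y2 => jsd (V1 false y1) (V1 true y1) *
  (`|V2 false y2 - V2 true y2| / 2))) /=.
apply: ler_sum => y _; rewrite box_jsd ![_ / 2]mulrC jsdZ ?invr_ge0 //.
rewrite [X in _ <= X]mulrCA ler_pM2l ?invr_gt0 //.
by rewrite [X in _ <= X]mulrC jsd_mix ?trans_ge0.
Qed.

Lemma capacity_box_ler : capacity (box V1 V2) <= capacity V2 * total_variation V1.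
Proof.
rewrite !capacityE -mulrAC ler_pM2r ?invr_gt0 ?ln2_gt0 // mulr_suml.
under [X in _ <= X]eq_bigr => y2 _ do rewrite mulr_sumr.
rewrite exchange_big (pair_bigA _ (fun y1 y2 => jsd (V2 false y2) (V2 true y2) *
  (`|V1 false y1 - V1 true y1| / 2))) /=.
apply: ler_sum => y _; rewrite box_jsd ![_ / 2]mulrC jsdZ ?invr_ge0 //.
rewrite [X in _ <= X]mulrCA ler_pM2l ?invr_gt0 // [X in _ <= X]mulrC.
have := @jsd_mix R (V2 false y.2) (V2 true y.2) (V1 false y.1) (V1 true y.1).
rewrite [V1 true _ * _ + _]addrC ![V1 _ _ * _]mulrC.
by apply; rewrite trans_ge0.
Qed.

(** Here [u] is the box capacity, so [x + y - u - u] is the gap. Weighted by [x], [(1 - y) ^+ 2]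
    costs 8 gaps ([h1]), and replacing it by [(1 - x) ^+ 2] costs 2 more ([h2]). *)
Let gap_bound (x y u A : R) : 0 <= x <= 1 -> 0 <= y <= 1 ->
  u <= x -> u <= y -> u <= x * A -> (1 - y) ^+ 2 <= 8 * (1 - A) ->
  (x * (1 - x)) ^+ 2 <= 10 * (x + y - u - u).
Proof.
move=> /andP[x0 x1] /andP[y0 y1] ux uy uA hA.
have h1 : x * (1 - y) ^+ 2 <= 8 * (x - u) by nra.
have h2 : x * ((y - x) * (2 - x - y)) <= 2 * (x + y - u - u).
  have m0 : 0 <= x * (2 - x - y) by nra.
  have m2 : x * (2 - x - y) <= 2 by nra.
  rewrite mulrCA (le_trans (ler_wpM2r m0 (_ : _ <= x + y - u - u))) //; first lra.
  by rewrite mulrC ler_wpM2r //; lra.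
have h3 : x * (1 - x) ^+ 2 <= 10 * (x + y - u - u).
  have -> : x * (1 - x) ^+ 2 = x * (1 - y) ^+ 2 + x * ((y - x) * (2 - x - y)) by ring.
  lra.
apply: le_trans h3.
by rewrite exprMn ler_wpM2r ?sqr_ge0 // expr2 ler_piMl.
Qed.

Lemma capacity_gap :
  (capacity V1 * (1 - capacity V1)) ^+ 2 + (capacity V2 * (1 - capacity V2)) ^+ 2
    <= 20 * (capacity (star V1 V2) - capacity (box V1 V2)).
Proof.
have I1 : 0 <= capacity V1 <= 1 by rewrite capacity_ge0 capacity_le1.
have I2 : 0 <= capacity V2 <= 1 by rewrite capacity_ge0 capacity_le1.
have hl := capacity_box_lel; have hr := capacity_box_ler.
have h1 : capacity (box V1 V2) <= capacity V1.
  by rewrite (le_trans hl) // ler_piMr ?capacity_ge0 ?total_variation_le1.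
have h2 : capacity (box V1 V2) <= capacity V2.
  by rewrite (le_trans hr) // ler_piMr ?capacity_ge0 ?total_variation_le1.
have := gap_bound I1 I2 h1 h2 hl (sqr_capacity_defect V2).
have := gap_bound I2 I1 h2 h1 hr (sqr_capacity_defect V1).
have := capacity_box_star; lra.
Qed.

End Capacity.

(** * Polarization of the generated channels *)

Section Polarization.
Variables (R : realType) (Y : finType) (W : nat -> bdmc R Y).

(** Blocks and positions count from 0, channels from 1. *)
Definition block_capacity (q k r : nat) : R :=
  capacity (generated W q (k * 2 ^ q + r).+1).

Lemma block_capacity01 q k r : 0 <= block_capacity q k r <= 1.
Proof. by rewrite capacity_ge0 capacity_le1. Qed.

Lemma block_capacity_box q k r : (r < 2 ^ q)%N ->
  block_capacity q.+1 k (2 * r) =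
  capacity (box (generated W q (2 * k * 2 ^ q + r).+1)
                (generated W q ((2 * k).+1 * 2 ^ q + r).+1)).
Proof.
move=> rq; rewrite /block_capacity.
have := @generated_odd R Y W q k (2 * k * 2 ^ q + r).+1 ltac:(lia).
have -> : (2 * (2 * k * 2 ^ q + r).+1 - 2 * k * 2 ^ q - 1 =
  (k * 2 ^ q.+1 + 2 * r).+1)%N by rewrite expnS; lia.
have -> : ((2 * k * 2 ^ q + r).+1 + 2 ^ q = ((2 * k).+1 * 2 ^ q + r).+1)%N by lia.
by move=> ->.
Qed.

Lemma block_capacity_star q k r : (r < 2 ^ q)%N ->
  block_capacity q.+1 k (2 * r).+1 =
  capacity (star (generated W q (2 * k * 2 ^ q + r).+1)
                 (generated W q ((2 * k).+1 * 2 ^ q + r).+1)).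
Proof.
move=> rq; rewrite /block_capacity.
have := @generated_even R Y W q k (2 * k * 2 ^ q + r).+1 ltac:(lia).
have -> : (2 * (2 * k * 2 ^ q + r).+1 - 2 * k * 2 ^ q =
  (k * 2 ^ q.+1 + (2 * r).+1).+1)%N by rewrite expnS; lia.
have -> : ((2 * k * 2 ^ q + r).+1 + 2 ^ q = ((2 * k).+1 * 2 ^ q + r).+1)%N by lia.
by move=> ->.
Qed.

Lemma block_capacity_sum q k r : (r < 2 ^ q)%N ->
  block_capacity q.+1 k (2 * r) + block_capacity q.+1 k (2 * r).+1 =
  block_capacity q (2 * k) r + block_capacity q (2 * k).+1 r.
Proof.
by move=> rq; rewrite block_capacity_box // block_capacity_star // capacity_box_star.
Qed.

Lemma block_capacity_lel q k r : (r < 2 ^ q)%N ->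
  block_capacity q.+1 k (2 * r) <= block_capacity q (2 * k) r.
Proof.
move=> rq; rewrite block_capacity_box // (le_trans (capacity_box_lel _ _)) //.
by rewrite ler_piMr ?capacity_ge0 ?total_variation_le1.
Qed.

Lemma block_capacity_ler q k r : (r < 2 ^ q)%N ->
  block_capacity q.+1 k (2 * r) <= block_capacity q (2 * k).+1 r.
Proof.
move=> rq; rewrite block_capacity_box // (le_trans (capacity_box_ler _ _)) //.
by rewrite ler_piMr ?capacity_ge0 ?total_variation_le1.
Qed.

Lemma block_capacity_gap q k r : (r < 2 ^ q)%N ->
  (block_capacity q (2 * k) r * (1 - block_capacity q (2 * k) r)) ^+ 2 +
  (block_capacity q (2 * k).+1 r * (1 - block_capacity q (2 * k).+1 r)) ^+ 2 <=
  20 * (block_capacity q.+1 k (2 * r).+1 - block_capacity q.+1 k (2 * r)).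
Proof.
move=> rq; rewrite block_capacity_box // block_capacity_star //.
exact: capacity_gap.
Qed.

Definition avg_generated (g : R -> R) (n : nat) : R :=
  (2 ^ n)%:R^-1 * \sum_(i < 2 ^ n) g (capacity (generated W n i.+1)).

Lemma avg_generatedE g n :
  avg_generated g n = (2 ^+ n)^-1 * level_sum block_capacity g n 0.
Proof.
rewrite /avg_generated natrX /level_sum big_mkord; congr (_ * _).
by apply: eq_bigr => r _; rewrite big_nat1 /block_capacity mul0n add0n.
Qed.

(** Each level preserves the sum of capacities; at level 0 every block is a single given channel. *)
Lemma avg_generated_id n : avg_generated id n = avg_capacity W n.
Proof.
rewrite avg_generatedE /avg_capacity natrX; congr (_ * _).
have step p q : level_sum block_capacity id (q + p) 0 = level_sum block_capacity id q p.
  elim: p q => [|p IH] q; first by rewrite addn0.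
  by rewrite addnS -addSn IH level_sum_id //; exact: block_capacity_sum.
have := step n 0; rewrite add0n => ->.
rewrite /level_sum expn0 big_nat1 big_add1 /=.
by apply: eq_bigr => k _; rewrite /block_capacity expn0 muln1 addn0.
Qed.

Lemma avg_spread_cvg0 :
  avg_generated (fun x => x * (1 - x)) n @[n --> \oo] --> (0 : R).
Proof.
apply/cvgrPdist_lt => e e0.
have e4 : 0 < e ^+ 4 by rewrite exprn_gt0.
near=> n; rewrite sub0r normrN.
have s0 : 0 <= avg_generated (fun x => x * (1 - x)) n.
  rewrite mulr_ge0 ?invr_ge0 ?ler0n // sumr_ge0 // => i _.
  by rewrite mulr_ge0 ?subr_ge0 ?capacity_ge0 ?capacity_le1.
rewrite ger0_norm // ltNge; apply/negP => es.
have := spread_decay block_capacity01 block_capacity_sum block_capacity_lel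
  block_capacity_ler block_capacity_gap n.
rewrite -avg_generatedE => h.
(* A spread of at least [e] would bound [n]; 20 is the constant of [block_capacity_gap]. *)
have : n%:R * e ^+ 4 <= 20 ^+ 2.
  by apply: le_trans h; rewrite ler_wpM2l // ler_pXn2r // nnegrE ltW.
apply/negP; rewrite -ltNge -ltr_pdivrMr //.
near: n; exact: nbhs_infty_gtr.
Unshelve. all: by end_near. Qed.

Lemma capacity_fractionE n (J : interval R) :
  capacity_fraction W n J = avg_generated (fun x => (x \in J)%:R) n.
Proof.
rewrite /capacity_fraction -sum1_card natr_sum big_mkcond; congr (_ * _).
by apply: eq_bigr => i _; rewrite inE; case: (_ \in _).
Qed.

(** The indicator of [J] may be traded for [g]: the error is dominated by the spread, whose average
    tends to 0. *)
Lemma capacity_fraction_cvg (J : interval R) (g : R -> R) (C l : R) :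
  (forall x, 0 <= x <= 1 -> `|(x \in J)%:R - g x| <= C * (x * (1 - x))) ->
  avg_generated g n @[n --> \oo] --> l ->
  capacity_fraction W n J @[n --> \oo] --> l.
Proof.
move=> hJ gl.
have bound n : `|capacity_fraction W n J - avg_generated g n| <=
    C * avg_generated (fun x => x * (1 - x)) n.
  rewrite capacity_fractionE -mulrBr normrM ger0_norm ?invr_ge0 ?ler0n //.
  rewrite [X in _ <= X]mulrCA ler_wpM2l ?invr_ge0 ?ler0n // -sumrB mulr_sumr.
  rewrite (le_trans (ler_norm_sum _ _ _)) //; apply: ler_sum => i _.
  by apply: hJ; rewrite capacity_ge0 capacity_le1.
have d0 : (capacity_fraction W n J - avg_generated g n) @[n --> \oo] --> (0 : R).
  apply: norm_cvg0; apply: (@squeeze_cvgr _ _ _ _ (fun=> 0)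
    (fun n => C * avg_generated (fun x => x * (1 - x)) n)).
  - by apply: nearW => n; rewrite bound normr_ge0.
  - exact: cvg_cst.
  - by rewrite -[X in _ --> X](mulr0 C); apply: cvgMr; exact: avg_spread_cvg0.
rewrite -[l]add0r.
under eq_fun => n do
  rewrite -[capacity_fraction W n J](subrK (avg_generated g n)).
exact: cvgD.
Qed.

Lemma avg_generated_compl n :
  avg_generated (fun x => 1 - x) n = 1 - avg_generated id n.
Proof.
rewrite /avg_generated sumrB mulrBr sumr_const card_ord -[1 *+ _]/(_%:R).
by rewrite mulVf // pnatr_eq0 -lt0n expn_gt0.
Qed.

End Polarization.

Theorem theorem1 (R : realType) (Y : finType) (W : nat -> bdmc R Y) (Ibar : R)
    (hIbar : avg_capacity W n @[n --> \oo] --> Ibar)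
    (delta : R) (hdelta : 0 < delta < 1) :
  (capacity_fraction W n `]1 - delta, 1] @[n --> \oo] --> Ibar) /\
  (capacity_fraction W n `[0, delta[ @[n --> \oo] --> 1 - Ibar).
Proof.
have /andP[d0 d1] := hdelta.
have d'0 : 0 < 1 - delta by rewrite subr_gt0.
(* With this [C], a factor [x] or [1 - x] that is at least [delta] or at least [1 - delta] becomes
   at least 1 when multiplied by [C]. This dominates the distance of the two indicators to [x] and
   to [1 - x] respectively. *)
pose C := delta^-1 + (1 - delta)^-1.
have C1 : 1 <= C * delta by rewrite /C mulrDl mulVf ?gt_eqF // lerDl mulr_ge0 ?invr_ge0 ?ltW.
have C2 : 1 <= C * (1 - delta).
  by rewrite /C mulrDl (mulVf (lt0r_neq0 d'0)) lerDr mulr_ge0 ?invr_ge0 ?ltW.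
have hid : (fun n => avg_generated W id n) = avg_capacity W.
  by apply/funext => n; exact: avg_generated_id.
split.
- apply: (@capacity_fraction_cvg _ _ W _ id C); last by rewrite hid.
  move=> x /andP[x0 x1]; rewrite in_itv /= x1 andbT.
  case: (ltP (1 - delta) x) => hx /=.
    rewrite ger0_norm; last lra.
    have : 1 <= C * x by nra.
    nra.
  rewrite sub0r normrN ger0_norm //.
  have : 1 <= C * (1 - x) by nra.
  nra.
- apply: (@capacity_fraction_cvg _ _ W _ (fun x => 1 - x) C).
    move=> x /andP[x0 x1]; rewrite in_itv /= x0 /=.
    case: (ltP x delta) => hx /=.
      rewrite opprB addrC subrK ger0_norm //.
      have : 1 <= C * (1 - x) by nra.
      nra.
    rewrite sub0r normrN ger0_norm; last lra.
    have : 1 <= C * x by nra.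
    nra.
  under eq_fun do rewrite avg_generated_compl avg_generated_id.
  by apply: cvgB => //; exact: cvg_cst.
Qed.
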